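(* Let $d \geq 3$ be an integer and let $q \equiv -1 \pmod d$ be an odd prime power such that $q>10d^4/(d-1)^2$. Let $u \in \mathbb{F}_{q^2}\setminus \mathbb{F}_q$ and let $N(u)$ be the $\mathbb{F}_q$-neighborhood of $u$ in the $d$-Paley graph $GP(q^2,d)$. Then the following statements hold: (a) If $d \nmid \frac{q+1}{2}$, then $N(u) \cup \{u\}$ forms a maximal clique of size $\frac{q+1}{d}$ in $GP(q^2,d)$. (b) If $d \mid \frac{q+1}{2}$, then $N(u) \cup \{u,u^q\}$ forms a maximal clique of size $\frac{q+d+1}{d}$ in $GP(q^2,d)$.
   Context: For an integer $d\ge 2$ and a prime power $Q\equiv 1 \pmod{2d}$, the $d$-Paley graph $GP(Q,d)$ is the graph with vertex set the finite field $\mathbb{F}_Q$ in which two vertices are adjacent if and only if their difference is a $d$-th power in $\mathbb{F}_Q^*=\mathbb{F}_Q\setminus\{0\}$. The $\mathbb{F}_q$-neighborhood of $u\in \mathbb{F}_{q^2}\setminus\mathbb{F}_q$ in $GP(q^2,d)$ is $N(u)=\{x \in \mathbb{F}_q : u-x \text{ is a } d\text{-th power in } \mathbb{F}_{q^2}^*\}$. A clique is a set of vertices any two distinct elements of which are adjacent; a maximal clique is a clique that cannot be extended to a larger clique by adding a new vertex. (The cliques in (a) and (b) are those called cliques obtained from the $(\mathbb{F}_q,\alpha)$-construction.) *)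

(* Defs.v *)
From HB Require Import structures.
From mathcomp Require Import all_boot all_order all_algebra all_fingroup all_field.

Set Implicit Arguments.
Unset Strict Implicit.
Unset Printing Implicit Defensive.

Import Order.TTheory GRing.Theory Num.Theory.

Local Open Scope ring_scope.

Definition prime_power (q : nat) : Prop :=
  exists p k : nat, [/\ prime p, (0 < k)%N & q = (p ^ k)%N].

Definition nz_dth_power (F : finFieldType) (d : nat) (x : F) : bool :=
  [exists z : F, (z != 0) && (x == z ^+ d)].

(* The graph GP(#|F|, d). The relation is symmetric when #|F| = 1 mod 2d,
   since -1 is then a d-th power. *)
Definition paley (F : finFieldType) (d : nat) : rel F :=
  fun x y => nz_dth_power d (x - y).

Definition clique (T : finType) (e : rel T) (C : {set T}) : Prop :=
  {in C &, forall x y, x != y -> e x y}.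

Definition maximal_clique (T : finType) (e : rel T) (C : {set T}) : Prop :=
  clique e C /\ (forall v : T, v \notin C -> ~ clique e (v |: C)).

Definition subfield_set (F : finFieldType) (K : {set F}) : Prop :=
  GRing.divring_closed K.

Definition nbhd (F : finFieldType) (K : {set F}) (d : nat) (u : F) : {set F} :=
  [set x in K | nz_dth_power d (u - x)].

(* Main.v *)
(* Put m = (q + 1) / d.  For u outside K and x in K, u - x is a d-th power iff
   (x - u^q)^m = (x - u)^m.  The polynomial P_u = (X - u^q)^m - (X - u)^m has
   degree m - 1 and divides (X - u^q)^(q+1) - (X - u)^(q+1), a multiple of
   X^q - X, so it splits over K with simple roots; hence |N(u)| = m - 1 and N(u)
   determines P_u up to a scalar.  If a vertex v extends the clique, then
   N(u) = N(v), so the m-th powers of X - u^q, X - u, X - v^q and X - v satisfy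
   a linear relation with nonzero coefficients.  If the four points are
   distinct, eliminating terms by differentiation shows that this forces
   m = p^e + 1, which is impossible since d < m. *)
Require Import Defs.
From HB Require Import structures.
From mathcomp Require Import all_boot all_order all_algebra all_fingroup all_field.
From mathcomp Require Import ring lra.

Set Implicit Arguments.
Unset Strict Implicit.
Unset Printing Implicit Defensive.

Import Order.TTheory GRing.Theory Num.Theory.

Local Open Scope ring_scope.

(** * Frobenius powers *)

Lemma exprBn_pnat (R : comNzRingType) (x y : R) (n : nat) :
  [pchar R].-nat n -> (x - y) ^+ n = x ^+ n - y ^+ n.
Proof.
by move=> n_p; apply/eqP; rewrite eq_sym subr_eq -exprDn_pchar // subrK.
Qed.

Lemma expr_pnat_inj (R : idomainType) (n : nat) :
  [pchar R].-nat n -> injective (fun x : R => x ^+ n).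
Proof.
move=> n_p x y /eqP; rewrite -subr_eq0 -exprBn_pnat // expf_eq0 subr_eq0.
by case/andP=> _ /eqP.
Qed.

(** * Linear relations between powers of linear polynomials *)

Section LinearPowerRelations.

Variables (F : fieldType) (I : eqType).
Implicit Types (k a : I -> F) (s : seq I) (m n : nat) (t : F).

Definition lin_pow_sum s k a m : {poly F} :=
  \sum_(i <- s) k i *: ('X - (a i)%:P) ^+ m.

Lemma lin_pow_sum_deriv s k a m t : m%:R != 0 :> F ->
  lin_pow_sum s k a m = 0 ->
  lin_pow_sum s (fun i => k i * (a i - t)) a m.-1 = 0.
Proof.
move=> m_neq0 sum0; apply/eqP.
have m_gt0 : (0 < m)%N by case: m m_neq0 {sum0}; rewrite ?eqxx.
(* This is the combination (X - t) E' - m E of the relation E. *)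
have : ('X - t%:P) * (lin_pow_sum s k a m)^`() - m%:R *: lin_pow_sum s k a m
       = m%:R *: lin_pow_sum s (fun i => k i * (a i - t)) a m.-1.
  rewrite /lin_pow_sum raddf_sum /= mulr_sumr !scaler_sumr -sumrB.
  apply: eq_bigr => i _.
  rewrite derivZ deriv_exp derivXsubC mul1r.
  have -> : ('X - (a i)%:P) ^+ m = ('X - (a i)%:P) * ('X - (a i)%:P) ^+ m.-1.
    by rewrite -exprS prednK.
  rewrite -!mul_polyC polyCM polyCB -mulr_natr -polyC_natr.
  by ring.
rewrite sum0 linear0 mulr0 scaler0 subr0 => /esym/eqP.
by rewrite scaler_eq0 (negPf m_neq0).
Qed.

(** Choosing [t = a i] kills the coefficient of [i], at the cost of one degree. *)
Lemma lin_pow_sum_elim i s k a m : m%:R != 0 :> F ->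
  lin_pow_sum (i :: s) k a m = 0 ->
  lin_pow_sum s (fun j => k j * (a j - a i)) a m.-1 = 0.
Proof.
move=> m_neq0 /(lin_pow_sum_deriv (a i) m_neq0).
by rewrite /lin_pow_sum big_cons subrr mulr0 scale0r add0r.
Qed.

Lemma lin_pow_sum2_neq0 i j k a n : (0 < n)%N -> a i != a j -> k i != 0 ->
  lin_pow_sum [:: i; j] k a n != 0.
Proof.
(* At [a j] the second term vanishes, since [0 < n], and the first does not. *)
move=> n_gt0 aij ki; apply/eqP => /(congr1 (horner^~ (a j))) /eqP.
rewrite /lin_pow_sum big_cons big_seq1 !hornerE subrr.
rewrite expr0n eqn0Ngt n_gt0 mulr0 addr0 mulf_eq0 (negPf ki) expf_eq0.
by rewrite subr_eq0 eq_sym (negPf aij) andbF.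
Qed.

Lemma lin_pow_sum3_neq0 i j l k a m : m%:R != 0 :> F -> (1 < m)%N ->
  uniq (map a [:: i; j; l]) -> k j != 0 ->
  lin_pow_sum [:: i; j; l] k a m != 0.
Proof.
move=> m_neq0 m_gt1 /=; rewrite !inE negb_or => /and3P[/andP[aij ail] ajl _] kj.
apply/eqP => /(lin_pow_sum_elim m_neq0)/eqP; apply/negP.
apply: lin_pow_sum2_neq0; [by case: m m_gt1 {m_neq0} => [|[]] | by [] |].
by rewrite mulf_neq0 // subr_eq0 eq_sym.
Qed.

Lemma lin_pow_sum_comp_pchar s k a P m : (0 < P)%N -> [pchar F].-nat P ->
  lin_pow_sum s k a (P * m) = lin_pow_sum s k (fun i => a i ^+ P) m \Po 'X^P.
Proof.
move=> P_gt0 P_nat; rewrite /lin_pow_sum raddf_sum /=; apply: eq_bigr => i _.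
rewrite comp_polyZ rmorphXn /= comp_polyB comp_polyX comp_polyC exprM.
by rewrite exprBn_pnat ?rmorphXn // (eq_pnat _ (@pchar_poly F)).
Qed.

(* Two elimination steps leave exponent m - 2.  If m - 1 vanishes in F, the
   second one is impossible; then m - 1 = P n with P a power of p and n prime to p, and
   the three-term relation is one between n-th powers in the variable X^P. *)
Lemma lin_pow_sum4_neq0 p i j l r k a m : p \in [pchar F] ->
  m%:R != 0 :> F -> (2 < m)%N -> (forall e, m != (p ^ e).+1) ->
  uniq (map a [:: i; j; l; r]) -> k l != 0 ->
  lin_pow_sum [:: i; j; l; r] k a m != 0.
Proof.
move=> p_ch m_neq0 m_gt2 m_form.
rewrite map_cons cons_uniq => /andP[ai_notin uniq_a] kl.
apply/eqP => /(lin_pow_sum_elim m_neq0).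
set k' := (fun i => _) => sum0.
have k'l : k' l != 0.
  rewrite mulf_neq0 // subr_eq0; apply: contraNneq ai_notin => <-.
  by rewrite !inE eqxx orbT.
have [m1_eq0|m1_neq0] := eqVneq (m.-1%:R : F) 0; last first.
  move/eqP: sum0; apply/negP; apply: lin_pow_sum3_neq0 => //.
  by case: m m_gt2 {m_neq0 m_form m1_neq0} => [|[|[]]].
have p_pr := pcharf_prime p_ch.
have m1_gt1 : (1 < m.-1)%N.
  by case: m m_gt2 {m_neq0 m_form sum0 m1_eq0} => [|[|[]]].
have [n] := pfactor_coprime p_pr (ltnW m1_gt1).
set P := (p ^ _)%N; rewrite prime_coprime // => p_n m1E.
have P_gt0 : (0 < P)%N by rewrite expn_gt0 prime_gt0.
have P_nat : [pchar F].-nat P.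
  by rewrite pnatX (eq_pnat _ (pcharf_eq p_ch)) pnat_id ?orbT.
move/eqP: sum0; rewrite m1E mulnC lin_pow_sum_comp_pchar //.
rewrite comp_poly_eq0 ?size_polyXn ?ltnS //; apply/negP.
apply: lin_pow_sum3_neq0 => //.
- by rewrite -(dvdn_pcharf p_ch).
- case: n p_n m1E => [|[|//]]; rewrite ?dvdn0 // mul1n => _ m1E.
  have := m_form (logn p m.-1); rewrite -/P -m1E prednK ?eqxx //.
  exact: ltn_trans m_gt2.
- by move: uniq_a; rewrite -(map_inj_uniq (expr_pnat_inj P_nat)) -map_comp.
Qed.

End LinearPowerRelations.


(** * The numerical bound, and auxiliary facts on polynomials *)

(** Turns the lower bound on q into d^2 < q, which yields d < m. *)
Lemma sqr_le_threshold (R : realFieldType) (x : R) : 1 < x ->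
  x ^+ 2 <= 10%:R * x ^+ 4 / (x - 1) ^+ 2.
Proof.
move=> x_gt1; rewrite ler_pdivlMr ?exprn_gt0 ?subr_gt0 // -subr_ge0.
have -> : 10%:R * x ^+ 4 - x ^+ 2 * (x - 1) ^+ 2
          = x ^+ 2 * (9%:R * x ^+ 2 + (2%:R * x - 1)) by ring.
by apply: mulr_ge0; have := sqr_ge0 x => //; lra.
Qed.

(** The linear factors are distinct, so a divisor is associate to a subproduct, necessarily the one
    over its own roots. *)
Lemma eqp_prod_XsubC_root (F : finFieldType) (P : {poly F}) (K : {set F}) :
  P %| \prod_(x in K) ('X - x%:P) ->
  P %= \prod_(x in K | root P x) ('X - x%:P).
Proof.
rewrite -big_enum => /dvdp_prod_XsubC[b eqP].
set rs := mask b (enum K) in eqP.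
have rs_uniq : uniq rs by rewrite mask_uniq ?enum_uniq.
have rootE x : root P x = (x \in rs) by rewrite (eqp_root eqP) root_prod_XsubC.
suff -> : \prod_(x in K | root P x) ('X - x%:P) = \prod_(x <- rs) ('X - x%:P).
  exact: eqP.
rewrite [RHS]big_uniq //=; apply: eq_bigl => x; rewrite rootE andb_idl //.
by move=> /mem_mask; rewrite mem_enum.
Qed.

(** The difference of powers is the nonzero constant [b - a] times a sum of m monic polynomials of
    degree m - 1, whose coefficient in that degree is m. *)
Lemma size_sub_XsubC_exp (F : fieldType) (a b : F) (m : nat) :
  m%:R != 0 :> F -> a != b ->
  size (('X - a%:P) ^+ m - ('X - b%:P) ^+ m) = m.
Proof.
move=> m_neq0 ab.
have m_gt0 : (0 < m)%N by case: m m_neq0; rewrite ?eqxx.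
rewrite subrXX; set S := \sum_(i < m) _.
have -> : 'X - a%:P - ('X - b%:P) = (b - a)%:P by rewrite polyCB; ring.
rewrite mul_polyC size_scale ?subr_eq0 1?eq_sym //.
have monicT (i : 'I_m) :
    ('X - a%:P) ^+ (m.-1 - i) * ('X - b%:P) ^+ i \is monic.
  by rewrite rpredM ?rpredX ?monicXsubC.
have sizeT (i : 'I_m) :
    size (('X - a%:P) ^+ (m.-1 - i) * ('X - b%:P) ^+ i) = m.
  rewrite size_Mmonic ?rpredX ?monicXsubC ?expf_neq0 ?polyXsubC_eq0 //.
  rewrite !size_exp_XsubC addSn /= addnS subnK ?prednK //.
  by rewrite -ltnS prednK.
apply/eqP; rewrite eqn_leq; apply/andP; split.
  apply: leq_trans (size_sum _ _ _) _.
  by apply/bigmax_leqP => i _; rewrite sizeT.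
rewrite leqNgt; apply: contra m_neq0 => size_lt.
have : S`_m.-1 = 0 by rewrite nth_default // -ltnS prednK.
rewrite coef_sum (eq_bigr (fun=> 1)) => [|i _].
  by rewrite sumr_const card_ord => ->.
by have := monicT i; rewrite monicE lead_coefE sizeT => /eqP.
Qed.

(** * The subfield K as the fixed field of the q-th power map *)

Section QuadraticExtension.

Variables (p k q d m : nat) (F : finFieldType) (K : {set F}).
Hypotheses (p_ch : p \in [pchar F]) (qE : q = (p ^ k)%N).
Hypothesis cardF : #|F| = (q ^ 2)%N.
Hypotheses (K_field : subfield_set K) (cardK : #|K| = q).
Hypothesis mdE : (m * d)%N = q.+1.

Let q_gt1 : (1 < q)%N.
Proof. by have := finNzRing_gt1 F; rewrite cardF -{1}(exp1n 2) ltn_exp2r. Qed.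

Let q_pnat : [pchar F].-nat q.
Proof.
by rewrite qE pnatX (eq_pnat _ (pcharf_eq p_ch)) pnat_id ?(pcharf_prime p_ch).
Qed.

Lemma natr_q_eq0 : q%:R = 0 :> F.
Proof.
apply/eqP; rewrite -(dvdn_pcharf p_ch) qE dvdn_exp //.
by case: k qE q_gt1 => // ->.
Qed.

(** Fermat's argument: multiplication by a nonzero [x] permutes the nonzero elements of [K]; compare
    their products. *)
Lemma subfield_expq x : x \in K -> x ^+ q = x.
Proof.
case: K_field => K1 KB Kdiv Kx.
have [->|x_neq0] := eqVneq x 0; first by rewrite expr0n gtn_eqF // ltnW.
have K0 : 0 \in K by rewrite -(subrr x) KB.
have KM y : y \in K -> x * y \in K.
  by move=> Ky; rewrite -[x]invrK mulrC Kdiv // -[x^-1]mul1r Kdiv.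
have imE : [set x * y | y in K :\ 0] = K :\ 0.
  apply/eqP; rewrite eqEcard card_imset ?leqnn ?andbT; last exact: mulfI.
  apply/subsetP => _ /imsetP[y + ->]; rewrite !inE mulf_eq0 negb_or x_neq0.
  by case/andP=> -> /KM.
have prodE : \prod_(y in K :\ 0) y = x ^+ q.-1 * \prod_(y in K :\ 0) y.
  rewrite -{1}imE big_imset /=; last by move=> ? ? _ _; exact: mulfI.
  have <- : #|K :\ 0| = q.-1 by rewrite -cardK [in RHS](cardsD1 0) K0.
  by rewrite big_split prodr_const.
have prod_neq0 : \prod_(y in K :\ 0) y != 0.
  by apply/prodf_neq0 => y; rewrite !inE => /andP[].
have : x ^+ q.-1 = 1 by apply: (mulIf prod_neq0); rewrite mul1r.
by rewrite -{2}(prednK (ltnW q_gt1)) exprS => ->; rewrite mulr1.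
Qed.

Lemma subfield_poly : 'X^q - 'X = \prod_(x in K) ('X - x%:P) :> {poly F}.
Proof.
have sizeX : (size (- 'X : {poly F}) < size ('X^q : {poly F}))%N.
  by rewrite size_polyN size_polyX size_polyXn.
rewrite -big_enum [LHS](@all_roots_prod_XsubC _ _ (enum K)).
- by rewrite lead_coefDl // lead_coefXn scale1r.
- by rewrite size_polyDl // size_polyXn -cardE cardK.
- apply/allP => x; rewrite mem_enum => Kx.
  by rewrite rootE !hornerE subfield_expq ?subrr.
- by rewrite uniq_rootsE enum_uniq.
Qed.

Lemma subfieldE x : (x \in K) = (x ^+ q == x).
Proof.
have := congr1 (root^~ x) subfield_poly.
by rewrite -big_enum root_prod_XsubC mem_enum rootE !hornerE subr_eq0 => ->.
Qed.

Lemma expqK (x : F) : (x ^+ q) ^+ q = x.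
Proof. by rewrite -exprM mulnn -cardF expf_card. Qed.

(** * A criterion for d-th powers *)

(** The group of units is cyclic of order m (q - 1) d, so its d-th powers are the solutions of z^(m
    (q - 1)) = 1; multiply by z^m. *)
Lemma nz_dth_powerE (z : F) :
  nz_dth_power d z = (z != 0) && (z ^+ (q * m) == z ^+ m).
Proof.
apply/existsP/andP => [[w /andP[w_neq0 /eqP->]]|[z_neq0 /eqP zqm]].
  rewrite expf_neq0 //; split=> //; apply/eqP.
  rewrite -!exprM mulnCA [(d * m)%N]mulnC mdE.
  by rewrite mulnS exprD mulnn -cardF expf_card exprS mulrC.
pose n := #|F|.-1.
have nE : n = (m * q.-1 * d)%N.
  rewrite /n cardF -subn1 -{2}(exp1n 2) subn_sqr subn1 addn1 -mdE.
  by rewrite mulnC mulnAC.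
have F_gt1 := finNzRing_gt1 F.
have n_gt0 : (0 < n)%N by rewrite -ltnS prednK ?(ltnW F_gt1).
have unity (x : F) : x != 0 -> x ^+ n = 1.
  move=> x_neq0; apply: (mulfI x_neq0); rewrite -exprS prednK ?(ltnW F_gt1) //.
  by rewrite expf_card mulr1.
have /hasP[g _ g_prim] : has n.-primitive_root (enum [set~ (0 : F)]).
  apply: cyclic.has_prim_root; rewrite ?enum_uniq //.
    by apply/allP => x; rewrite mem_enum !inE unity_rootE => /unity->.
  by rewrite -cardE cardsC1.
have [[i _] /= zE] := prim_rootP g_prim (unity _ z_neq0).
(* With z = g^i, the criterion says that m (q - 1) d divides m (q - 1) i. *)
have d_i : (d %| i)%N.
  move/eqP: zqm; rewrite zE -!exprM (eq_prim_root_expr g_prim).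
  rewrite eqn_mod_dvd; last by rewrite leq_mul2l leq_pmull ?orbT // ltnW.
  have -> : (i * (q * m) - i * m = m * q.-1 * i)%N.
    by rewrite -mulnBr -{2}[m]mul1n -mulnBl subn1 mulnC [(m * _)%N]mulnC.
  have m_gt0 : (0 < m)%N by move: mdE; case: (m).
  by rewrite nE dvdn_pmul2l // muln_gt0 m_gt0 -ltnS prednK // ltnW.
have d_gt0 : (0 < d)%N by move: mdE; case: (d); rewrite ?muln0.
exists (g ^+ (i %/ d)); rewrite zE -exprM divnK // eqxx andbT.
apply: contra z_neq0; rewrite zE -{2}(divnK d_i) exprM => /eqP->.
by rewrite expr0n gtn_eqF.
Qed.

Lemma nz_dth_powerN (z : F) : odd q -> nz_dth_power d (- z) = nz_dth_power d z.
Proof.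
move=> q_odd; rewrite !nz_dth_powerE oppr_eq0; congr (_ && _).
rewrite !(exprNn z) -[(-1) ^+ (q * m)]signr_odd oddM q_odd andTb signr_odd.
by rewrite (inj_eq (mulfI _)) // signr_eq0.
Qed.

Lemma nz_dth_power_expq (z : F) : nz_dth_power d z -> nz_dth_power d (z ^+ q).
Proof.
rewrite !nz_dth_powerE => /andP[z_neq0 /eqP zqm].
by rewrite expf_neq0 //= exprAC zqm exprAC.
Qed.

(** This makes [K] itself a clique. *)
Lemma nz_dth_power_subfield z : z \in K -> nz_dth_power d z = (z != 0).
Proof.
by rewrite subfieldE nz_dth_powerE exprM => /eqP->; rewrite eqxx andbT.
Qed.

(** The q-th power map negates u - u^q, so the criterion becomes (-1)^m = 1. This separates the two
    cases of the theorem. *)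
Lemma nz_dth_power_sub_conj (u : F) : odd q -> u ^+ q != u ->
  nz_dth_power d (u - u ^+ q) = ~~ odd m.
Proof.
move=> q_odd uq_neq; rewrite nz_dth_powerE subr_eq0 eq_sym uq_neq exprM.
rewrite exprBn_pnat // expqK -opprB exprNn -signr_odd.
(* If 2 = 0 in F, the odd number q would be 1 in F, but it is 0. *)
have two_neq0 : 2%:R != 0 :> F.
  apply/eqP => two0; have /eqP := natr_q_eq0.
  rewrite -(odd_double_half q) q_odd natrD -mul2n natrM two0 mul0r addr0.
  by rewrite oner_eq0.
have x_neq0 : (u - u ^+ q) ^+ m != 0 by rewrite expf_neq0 // subr_eq0 eq_sym.
case: (odd m); rewrite ?mul1r ?eqxx //= mulN1r -subr_eq0 -opprD oppr_eq0.
by rewrite -mulr2n -mulr_natl mulf_eq0 (negPf two_neq0) (negPf x_neq0).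
Qed.

(** * The polynomial P_u and its roots *)

Definition conj_pow_sub (u : F) : {poly F} :=
  ('X - (u ^+ q)%:P) ^+ m - ('X - u%:P) ^+ m.

Lemma conj_pow_sub_dvd (u : F) : u \notin K ->
  conj_pow_sub u %| \prod_(x in K) ('X - x%:P).
Proof.
rewrite subfieldE => uq_neq; rewrite -subfield_poly.
have Xq_nat : [pchar {poly F}].-nat q by rewrite (eq_pnat _ (@pchar_poly F)).
have frob a : ('X - a%:P) ^+ q = 'X^q - (a ^+ q)%:P :> {poly F}.
  by rewrite exprBn_pnat // rmorphXn.
(* As m d = q + 1, the two powers are (X^q - u)(X - u^q) and (X^q - u^q)(X - u); their difference is
   (u - u^q)(X^q - X). *)
have <- : (u - u ^+ q)^-1 *: (('X - (u ^+ q)%:P) ^+ (m * d)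
            - ('X - u%:P) ^+ (m * d)) = 'X^q - 'X.
  rewrite mdE !exprSr !frob expqK -[RHS]scale1r.
  rewrite -(@mulVf _ (u - u ^+ q)) ?subr_eq0 1?eq_sym // -scalerA.
  by congr (_ *: _); rewrite -mul_polyC polyCB; ring.
rewrite dvdpZr ?invr_eq0 ?subr_eq0 1?eq_sym //.
by rewrite !exprM [X in _ %| X]subrXX dvdp_mulr.
Qed.

(** In F, m d = q + 1 = 1. *)
Lemma natr_m_neq0 : m%:R != 0 :> F.
Proof.
have : (m * d)%:R = 1 :> F by rewrite mdE -natr1 natr_q_eq0 add0r.
by rewrite natrM; apply: contra_eq_neq => ->; rewrite mul0r eq_sym oner_neq0.
Qed.

Lemma size_conj_pow_sub (u : F) : u \notin K -> size (conj_pow_sub u) = m.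
Proof. by rewrite subfieldE => ?; rewrite size_sub_XsubC_exp ?natr_m_neq0. Qed.

Hypothesis q_odd : odd q.

(** For x in K, (x - u)^q = x - u^q, so the criterion for x - u says P_u(x) = 0. *)
Lemma mem_nbhd (u x : F) : u \notin K ->
  (x \in nbhd K d u) = (x \in K) && root (conj_pow_sub u) x.
Proof.
move=> uK; rewrite inE; case: (boolP (x \in K)) => //= xK.
rewrite -nz_dth_powerN // opprB nz_dth_powerE rootE !hornerE subr_eq0.
have -> : x != u by apply: contraNneq uK => <-.
by rewrite subr_eq0 exprM exprBn_pnat // subfield_expq.
Qed.

Lemma nbhd_eqp (u : F) : u \notin K ->
  conj_pow_sub u %= \prod_(x in nbhd K d u) ('X - x%:P).
Proof.
move=> uK; rewrite (eq_bigl _ _ (fun x => mem_nbhd x uK)).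
exact: eqp_prod_XsubC_root (conj_pow_sub_dvd uK).
Qed.

Lemma card_nbhd (u : F) : u \notin K -> #|nbhd K d u|.+1 = m.
Proof.
move=> uK; rewrite -[RHS](size_conj_pow_sub uK) (eqp_size (nbhd_eqp uK)).
by rewrite -big_enum size_prod_XsubC -cardE.
Qed.

(* If m = P + 1 with P = p^e, then reducing (P + 1) d = q + 1 modulo P gives
   P | d - 1, hence m <= d. *)
Lemma cofactor_neq_pchar_pow_succ e : (1 < d)%N -> (d < m)%N -> m != (p ^ e).+1.
Proof.
move=> d_gt1 d_lt_m; apply/eqP => mE.
have p_pr := pcharf_prime p_ch.
have P_dvd_q : (p ^ e %| q)%N.
  rewrite qE dvdn_Pexp2l ?prime_gt1 // -(leq_exp2l _ _ (prime_gt1 p_pr)) -qE.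
  by rewrite -ltnS -mE -mdE leq_pmulr // ltnW.
have : (p ^ e %| d.-1)%N.
  have := mdE; rewrite mE mulSn -(prednK (ltnW d_gt1)) addSn => -[qdE].
  by rewrite -qdE dvdn_addl ?dvdn_mulr in P_dvd_q.
rewrite -subn1 => /dvdn_leq; rewrite subn_gt0 d_gt1 => /(_ isT).
by rewrite leq_subRL ?(ltnW d_gt1) // add1n -mE leqNgt d_lt_m.
Qed.

Lemma nbhd_inj (u v : F) : (1 < d)%N -> (d < m)%N -> u \notin K -> v \notin K ->
  nbhd K d u = nbhd K d v -> v \in [set u; u ^+ q].
Proof.
move=> d_gt1 d_lt_m uK vK Nuv; apply/negPn/negP => v_notin.
have : conj_pow_sub u %= conj_pow_sub v.
  by rewrite (eqp_trans (nbhd_eqp uK)) // Nuv eqp_sym nbhd_eqp.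
case/eqpP => -[c1 c2] /= /andP[c1_neq0 c2_neq0] eq_uv.
(* The indices are pairs of a coefficient and a point, read off by [fst] and [snd]. *)
pose s := [:: (c1, u ^+ q); (- c1, u); (- c2, v ^+ q); (c2, v)].
have : lin_pow_sum s fst snd m == 0.
  have -> : lin_pow_sum s fst snd m = c1 *: conj_pow_sub u - c2 *: conj_pow_sub v.
    rewrite /lin_pow_sum !big_cons big_nil /= addr0 !scaleNr.
    by rewrite !scalerBr opprB -!addrA [- (c2 *: _) + _]addrC.
  by rewrite eq_uv subrr.
apply/negP; apply: (lin_pow_sum4_neq0 p_ch); rewrite ?oppr_eq0 //.
- exact: natr_m_neq0.
- exact: leq_ltn_trans d_lt_m.
- by move=> e; apply: cofactor_neq_pchar_pow_succ.
(* The four points are distinct because the q-th power map is an injective involution. *)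
move: v_notin uK vK; rewrite !subfieldE !inE negb_or => /andP[vu vuq] uq vq.
rewrite /= !inE !negb_or uq (eq_sym u v) vu (eq_sym _ v) vuq vq !andbT /=.
rewrite (inj_eq (expr_pnat_inj q_pnat)) eq_sym vu /=.
by apply: contraNneq vuq => ->; rewrite expqK.
Qed.

(** * Cliques and their extensions *)

Lemma paley_sym (x y : F) : paley d x y = paley d y x.
Proof. by rewrite /paley -nz_dth_powerN // opprB. Qed.

(** Both neighborhoods have m - 1 elements, so inclusion is equality. *)
Lemma nbhd_sub_inj (u v : F) : (1 < d)%N -> (d < m)%N ->
  u \notin K -> v \notin K ->
  nbhd K d u \subset nbhd K d v -> v \in [set u; u ^+ q].
Proof.
move=> d_gt1 d_lt_m uK vK Nuv; apply: nbhd_inj => //; apply/eqP.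
by rewrite eqEcard Nuv -ltnS !card_nbhd ?leqnn.
Qed.

(** Two points of N(u) differ by an element of [K]; and u^q - x = (u - x)^q for x in [K], so u^q is
    adjacent to all of N(u). *)
Lemma clique_nbhdU (u : F) (S : {set F}) :
  u \notin K -> S \subset [set u; u ^+ q] ->
  {in S &, forall x y, x != y -> paley d x y} ->
  clique (paley (F := F) d) (nbhd K d u :|: S).
Proof.
move=> uK /subsetP Su S_clique.
have NS x y : x \in nbhd K d u -> y \in S -> paley d y x.
  rewrite inE => /andP[xK ux_pow] /Su; rewrite !inE => /orP[]/eqP-> //.
  rewrite /paley -(subfield_expq xK) -exprBn_pnat //.
  exact: nz_dth_power_expq.
have NK x : x \in nbhd K d u -> x \in K by rewrite inE => /andP[].
move=> x y; rewrite !(in_setU x, in_setU y) => /orP[xN|xS] /orP[yN|yS] xy.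
- case: K_field => _ KB _.
  by rewrite /paley nz_dth_power_subfield ?subr_eq0 // KB // NK.
- by rewrite paley_sym NS.
- exact: NS.
- exact: S_clique.
Qed.

(** A new vertex in [K] would be adjacent to [u], hence already in N(u). Outside [K], its
    neighborhood contains N(u). *)
Lemma clique_extension_conj (u v : F) (S : {set F}) : (1 < d)%N -> (d < m)%N ->
  u \notin K -> u \in S -> v \notin nbhd K d u :|: S ->
  clique (paley (F := F) d) (v |: (nbhd K d u :|: S)) -> v = u ^+ q.
Proof.
move=> d_gt1 d_lt_m uK uS; rewrite in_setU negb_or => /andP[vN vS] v_clique.
have v_adj x : x \in nbhd K d u :|: S -> paley d v x.
  move=> x_in; apply: v_clique; rewrite ?setU11 ?setU1r //.
  by apply: contraTneq x_in => <-; rewrite in_setU negb_or vN.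
have vK : v \notin K.
  apply: contra vN => vK; rewrite inE vK -[nz_dth_power _ _]/(paley d u v).
  by rewrite paley_sym v_adj // in_setU uS orbT.
have : v \in [set u; u ^+ q].
  apply: nbhd_sub_inj => //; apply/subsetP => x xN.
  rewrite inE -[nz_dth_power _ _]/(paley d v x) v_adj ?in_setU ?xN // andbT.
  by move: xN; rewrite inE => /andP[].
by rewrite !inE => /orP[/eqP vE|/eqP //]; rewrite vE uS in vS.
Qed.

End QuadraticExtension.

(** * The two families of maximal cliques *)

Theorem theorem1p5 (d q : nat) (F : finFieldType) (K : {set F}) (u : F) :
  (3 <= d)%N ->
  prime_power q ->
  odd q ->
  (q%:Z = -1 %[mod d%:Z])%Z ->
  10%:R * d%:R ^+ 4 / (d%:R - 1) ^+ 2 < q%:R :> rat ->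
  #|F| = (q ^ 2)%N ->
  subfield_set K ->
  #|K| = q ->
  u \notin K ->
  (~~ (d %| q.+1 %/ 2)%N ->
     maximal_clique (paley (F := F) d) (nbhd K d u :|: [set u])
     /\ #|nbhd K d u :|: [set u]| = (q.+1 %/ d)%N)
  /\
  ((d %| q.+1 %/ 2)%N ->
     maximal_clique (paley (F := F) d) (nbhd K d u :|: [set u; u ^+ q])
     /\ #|nbhd K d u :|: [set u; u ^+ q]| = ((q + d + 1) %/ d)%N).
Proof.
move=> d_ge3 [p [k [p_pr _ qE]]] q_odd q_mod d_lt_q cardF K_field cardK uK.
have d_gt0 : (0 < d)%N by exact: leq_trans d_ge3.
have d_gt1 : (1 < d)%N by exact: leq_trans d_ge3.
have p_ch : p \in [pchar F].
  by apply: (@card_finPcharP _ _ (k * 2)); rewrite // cardF qE expnM.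
have d_dvd : (d %| q.+1)%N.
  by move/eqP: q_mod; rewrite eqz_mod_dvd opprK addrC -intS.
pose m := (q.+1 %/ d)%N; have mdE : (m * d)%N = q.+1 by rewrite divnK.
have d_lt_m : (d < m)%N.
  rewrite -(ltn_pmul2r d_gt0) mdE ltnS mulnn ltnW // -(ltr_nat rat) natrX.
  have d_gt1r : 1 < d%:R :> rat by rewrite ltr1n.
  exact: le_lt_trans (sqr_le_threshold d_gt1r) d_lt_q.
have m_even : (d %| q.+1 %/ 2)%N = ~~ odd m.
  have q1E : (q.+1 %/ 2 * 2 = m * d)%N by rewrite divnK ?mdE // dvdn2 /= q_odd.
  by rewrite -(@dvdn_pmul2r 2) // q1E mulnC dvdn_pmul2r // dvdn2.
have uK_neq : u ^+ q != u by rewrite -(subfieldE cardF K_field cardK).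
have conj_adj : paley d u (u ^+ q) = (d %| q.+1 %/ 2)%N.
  rewrite m_even; exact: (nz_dth_power_sub_conj p_ch qE cardF mdE).
have uN : u \notin nbhd K d u by rewrite inE (negPf uK).
have uqN : u ^+ q \notin nbhd K d u.
  rewrite inE (subfieldE cardF K_field cardK) (expqK cardF).
  by rewrite eq_sym (negPf uK_neq).
have cardN := card_nbhd p_ch qE cardF K_field cardK mdE q_odd uK.
have ext_conj v S := @clique_extension_conj _ _ _ _ _ _ _ p_ch qE cardF K_field
  cardK mdE q_odd u v S d_gt1 d_lt_m uK.
split=> dvd_half; (split; [split|]).
- apply: (clique_nbhdU p_ch qE cardF K_field cardK mdE) => //.
    by rewrite sub1set set21.
  by move=> x y /set1P-> /set1P->; rewrite eqxx.
- move=> v v_notin v_clique.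
  have vE := ext_conj _ _ (set11 u) v_notin v_clique.
  (* Only u^q could extend the clique, but it is not adjacent to u when m is odd. *)
  case/negP: dvd_half; rewrite -conj_adj -vE.
  apply: v_clique; rewrite ?inE ?eqxx ?orbT //.
  by rewrite vE eq_sym.
- by rewrite setUC cardsU1 uN add1n cardN.
- apply: (clique_nbhdU p_ch qE cardF K_field cardK mdE) => //.
  move=> x y; rewrite !inE => /orP[]/eqP-> /orP[]/eqP->; rewrite ?eqxx // => _.
    by rewrite conj_adj.
  by rewrite (paley_sym cardF mdE) // conj_adj.
- move=> v v_notin v_clique.
  have vE := ext_conj _ _ (set21 u _) v_notin v_clique.
  (* Here the only candidate u^q already belongs to the clique. *)
  by case/negP: v_notin; rewrite vE !inE eqxx !orbT.
(* The claimed size is thus m + 1: the m - 1 points of N(u), with u and u^q. *)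
have -> : (q + d + 1 = m.+1 * d)%N by rewrite addnAC addn1 -mdE mulSn addnC.
rewrite mulnK // setUC -setUA !cardsU1 in_setU1 negb_or eq_sym uK_neq uN uqN.
by rewrite !add1n cardN.
Qed.
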